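(* Let $X$ be a real Banach space, let $\mathcal{C}$ be a compatible class of bounded subsets of $X$, and let $\tau=\tau_{\mathcal{C}}$ be the topology on $X^*$ of uniform convergence on the members of $\mathcal{C}$. The following are equivalent: (a) $X$ has the strong $\mathcal{C}$-MIP. (b) Every $f \in S(X^* )$ is a strong $\mathcal{C}$-semidenting point of $B(X^* )$. (c) For every $\varepsilon>0$ and every $C\in\mathcal{C}$, $D(M_{\varepsilon,C}(X))$ is $\tau$-dense in $S(X^* )$. (d) The duality map on $X$ is norm-$\tau$ quasicontinuous. (e) Every support mapping in $X$ maps norm dense subsets of $S(X)$ to $\tau$-dense subsets of $S(X^* )$.
   Context: $B(X)=\{x:\|x\|\le 1\}$, $S(X)=\{x:\|x\|=1\}$ (similarly for $X^*$); $B(x,r)$ is the open ball and $B[x,r]$ the closed ball ($r>0$). Compatible class: a class $\mathcal{C}$ of bounded subsets of $X$ such that (I) $C\in\mathcal{C}$, $\alpha\in\mathbb{R}$, $x\in X$ imply $\alpha C+x\in\mathcal{C}$ and $C\cup\{x\}\in\mathcal{C}$; (II) $C\in\mathcal{C}$ implies the closed absolutely convex hull of $C$ is in $\mathcal{C}$; (III) $C\in\mathcal{C}$ and $A\subseteq C$ imply $A\in\mathcal{C}$; (IV) $C_1,C_2\in\mathcal{C}$ implies $C_1\cup C_2\in\mathcal{C}$. For bounded $A\subseteq X$ and $f\in X^*$, $\|f\|_A=\sup\{|f(x)|:x\in A\}$. For $A\in\mathcal{C}$, $f\in X^*$, $\varepsilon>0$, $B_A(f,\varepsilon)=\{g\in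 X^*:\|f-g\|_A<\varepsilon\}$. The topology $\tau_{\mathcal{C}}$ on $X^*$ is generated by the seminorms $\|\cdot\|_C$, $C\in\mathcal{C}$; the sets $B_C(0,\varepsilon)$, $C\in\mathcal{C}$, $\varepsilon>0$, form a local base at $0$. Strong $\mathcal{C}$-MIP: for every closed convex $C\in\mathcal{C}$ and every $\beta\ge 0$, the norm closure $\overline{C+\beta B(X)}$ is the intersection of the closed balls containing it. A w*-slice of $B(X^* )$ is a set $S(B(X^* ),x,\delta)=\{f\in B(X^* ): f(x)>1-\delta\}$ with $x\in S(X)$, $0<\delta<1$. A functional $f\in S(X^* )$ is a strong $\mathcal{C}$-semidenting point of $B(X^* )$ if for each $A\in\mathcal{C}$ and $\varepsilon>0$ there is a w*-slice $S$ of $B(X^* )$ with $S\subseteq B_A(f,\varepsilon)$. Duality map: for $x\in S(X)$, $D(x)=\{f\in S(X^* ):f(x)=1\}$; for $A\subseteq S(X)$, $D(A)=\bigcup_{x\in A}D(x)$. A support mapping is any selection of $D$, i.e. a map $\phi:S(X)\to S(X^* )$ with $\phi(x)\in D(x)$ for all $x\in S(X)$. The duality map is norm-$\tau$ quasicontinuous if for every $f\in S(X^* )$, $\varepsilon>0$ and $C\in\mathcal{C}$ there exist $\delta>0$ and $x\in S(X)$ such that $D(S(X)\cap B(x,\delta))\subseteq B_C(f,\varepsilon)$. For $\varepsilon,\delta>0$, $x\in S(X)$, $C\in\mathcal{C}$, let $$d_1(C,x,\delta)=\sup_{0<\lambda<\delta,\ y\in C}\frac{\|x+\lambda y\|+\|x-\lambda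 y\|-2}{\lambda},$$ $M_{\varepsilon,\delta,C}(X)=\{x\in S(X): d_1(C,x,\delta)<\varepsilon\}$ and $M_{\varepsilon,C}(X)=\bigcup_{\delta>0}M_{\varepsilon,\delta,C}(X)$. *)

(* Defs.v *)
From HB Require Import structures.
From mathcomp Require Import all_boot all_order all_algebra.
From mathcomp Require Import all_classical all_reals all_analysis.

Set Implicit Arguments.
Unset Strict Implicit.
Unset Printing Implicit Defensive.

Import Order.TTheory GRing.Theory Num.Theory.
Import numFieldNormedType.Exports.
Local Open Scope classical_set_scope.
Local Open Scope ring_scope.

Definition unit_ball (R : realType) (X : normedModType R) : set X :=
  [set x | `|x| <= 1].

Definition unit_sphere (R : realType) (X : normedModType R) : set X :=
  [set x | `|x| = 1].

Arguments unit_ball {R} X.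
Arguments unit_sphere {R} X.

Record dual (R : realType) (X : normedModType R) := Dual {
  dual_fun :> {linear X -> R^o};
  dual_continuous : continuous dual_fun }.

(* ||h||_A; the library's [sup] gives the intended value 0 when A is empty. *)
Definition seminorm_on (R : realType) (X : normedModType R) (A : set X)
    (h : X -> R) : R :=
  sup [set `|h x| | x in A].

Definition dual_norm (R : realType) (X : normedModType R) (f : dual X) : R :=
  seminorm_on (unit_ball X) f.

Definition dual_unit_ball (R : realType) (X : normedModType R) :
    set (dual X) :=
  [set f | dual_norm f <= 1].

Definition dual_unit_sphere (R : realType) (X : normedModType R) :
    set (dual X) :=
  [set f | dual_norm f = 1].

Arguments dual_unit_ball {R} X.
Arguments dual_unit_sphere {R} X.

Definition seminorm_ball (R : realType) (X : normedModType R) (A : set X)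
    (f : dual X) (e : R) : set (dual X) :=
  [set g : dual X | seminorm_on A (fun x => f x - g x) < e].

Definition absolutely_convex (R : realType) (X : normedModType R)
    (A : set X) : Prop :=
  convex_set A /\ forall (a : R) (x : X), `|a| <= 1 -> A x -> A (a *: x).

Definition closed_abs_convex_hull (R : realType) (X : normedModType R)
    (A : set X) : set X :=
  smallest [set B | closed B /\ absolutely_convex B] A.

Record compatible_class (R : realType) (X : normedModType R)
    (C : set (set X)) : Prop := {
  compatible_bounded : forall A, C A -> bounded_set A ;
  compatible_affine : forall A (a : R) (x : X),
    C A -> C [set a *: y + x | y in A] ;
  compatible_setU1 : forall A (x : X), C A -> C (A `|` [set x]) ;
  compatible_hull : forall A, C A -> C (closed_abs_convex_hull A) ;
  compatible_subset : forall A B, C A -> B `<=` A -> C B ;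
  compatible_setU : forall A B, C A -> C B -> C (A `|` B) }.

(* A copy of the dual space carrying the topology generated by the seminorms
   ||.||_A, A in C. *)
Definition tau_dual (R : realType) (X : normedModType R)
  (C : set (set X)) : Type := dual X.

Definition tau_subbase (R : realType) (X : normedModType R)
    (C : set (set X)) : set (set (tau_dual C)) :=
  [set U | exists A (f : dual X) (e : R),
    [/\ C A, 0 < e & U = seminorm_ball A f e]].

HB.instance Definition _ (R : realType) (X : normedModType R)
  (C : set (set X)) := gen_eqMixin (tau_dual C).
HB.instance Definition _ (R : realType) (X : normedModType R)
  (C : set (set X)) := gen_choiceMixin (tau_dual C).
HB.instance Definition _ (R : realType) (X : normedModType R)
  (C : set (set X)) :=
  @isSubBaseTopological.Build (tau_dual C) (set (tau_dual C))
    (tau_subbase (C := C)) id.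

(* Unlike the library's [dense], this is density of a subset A of S relative to
   the subspace S. *)
Definition dense_in (T : topologicalType) (S A : set T) : Prop :=
  A `<=` S /\ S `<=` closure A.

Definition tau_dense (R : realType) (X : normedModType R) (C : set (set X))
    (S A : set (dual X)) : Prop :=
  @dense_in (tau_dual C) S A.

(* [A !=set0] is needed for X = 0 only: see [bigcap_closed_balls_set0]. *)
Definition strong_MIP (R : realType) (X : normedModType R)
    (C : set (set X)) : Prop :=
  forall (A : set X) (b : R),
    C A -> A !=set0 -> closed A -> convex_set A -> 0 <= b ->
    let K := closure [set x + b *: y | x in A & y in unit_ball X] in
    K = \bigcap_(B in [set B | (exists x r, 0 < r /\ B = closed_ball x r) /\
                               K `<=` B]) B.

Definition weak_star_slice (R : realType) (X : normedModType R) (x : X)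
    (d : R) : set (dual X) :=
  [set f : dual X | dual_unit_ball X f /\ f x > 1 - d].

Definition strong_semidenting (R : realType) (X : normedModType R)
    (C : set (set X)) (f : dual X) : Prop :=
  forall (A : set X) (e : R), C A -> 0 < e ->
    exists (x : X) (d : R), [/\ unit_sphere X x, 0 < d < 1 &
      weak_star_slice x d `<=` seminorm_ball A f e].

Definition duality_map (R : realType) (X : normedModType R) (x : X) :
    set (dual X) :=
  [set f : dual X | dual_unit_sphere X f /\ f x = 1].

Definition duality_image (R : realType) (X : normedModType R) (A : set X) :
    set (dual X) :=
  \bigcup_(x in A) duality_map x.

(* Only the values on the unit sphere are constrained. *)
Definition support_mapping (R : realType) (X : normedModType R)
    (phi : X -> dual X) : Prop :=
  forall x, unit_sphere X x -> duality_map x (phi x).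

Definition norm_tau_quasicontinuous (R : realType) (X : normedModType R)
    (C : set (set X)) : Prop :=
  forall (f : dual X) (e : R) (A : set X),
    dual_unit_sphere X f -> 0 < e -> C A ->
    exists (d : R) (x : X), [/\ 0 < d, unit_sphere X x &
      duality_image (unit_sphere X `&` ball x d) `<=` seminorm_ball A f e].

Definition d1 (R : realType) (X : normedModType R) (A : set X) (x : X)
    (d : R) : R :=
  sup [set (`|x + l *: y| + `|x - l *: y| - 2) / l |
       l in [set l | 0 < l < d] & y in A].

Definition M_delta (R : realType) (X : normedModType R) (e d : R)
    (A : set X) : set X :=
  [set x | unit_sphere X x /\ d1 A x d < e].

Definition M_set (R : realType) (X : normedModType R) (e : R)
    (A : set X) : set X :=
  \bigcup_(d in [set d | 0 < d]) M_delta e d A.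

Lemma bigcap_closed_balls_set0 (R : realType) (X : normedModType R) (z : X) :
  z != 0 ->
  \bigcap_(B in [set B : set X | (exists x r, 0 < r /\ B = closed_ball x r) /\
                                 set0 `<=` B]) B = set0.
Proof.
move=> z0; have nz : 0 < `|z| by rewrite normr_gt0.
rewrite -subset0 => y yB.
pose t := 4 / `|z| *: z.
have nt : `|t| = 4.
  by rewrite normrZ gtr0_norm ?divr_gt0// divfK// gt_eqF.
have h (x : X) : `|x - y| <= 1.
  have : closed_ball x 1 y by apply: yB; split => //; exists x, 1.
  by rewrite closed_ballE.
have := ler_normB (y + t - y) (y - y).
have := h (y + t).
rewrite [y + t]addrC addrK nt => /le_trans/(_ (ler1n _ 3)).
by rewrite ler_nat.
Qed.

(* Main.v *)
Require Import Defs.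
From HB Require Import structures.
From mathcomp Require Import all_boot all_order all_algebra.
From mathcomp Require Import all_classical all_reals all_analysis.
From mathcomp Require Import lra.

Set Implicit Arguments.
Unset Strict Implicit.
Unset Printing Implicit Defensive.

Import Order.TTheory GRing.Theory Num.Theory.
Import numFieldNormedType.Exports.
Local Open Scope classical_set_scope.
Local Open Scope ring_scope.

(* If [x] is in [M_(e,C)], two functionals of the dual ball that nearly attain
   their norm at [x] nearly agree on [C]; conversely, if the functionals norming
   points near [x] nearly agree on [C], then [x] is in some [M_(e,C)]. This makes
   (b), (c) and (d) three readings of one approximation property. (e) gives (d)
   because a failure of (d) at [f] yields a dense set of points supporting
   functionals away from [f]. (a) and (b) are linked by passing between a large
   ball containing a set but not a point and the w*-slice in the direction of the
   centre of that ball. Norming and separating functionals both come from lowering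
   the norm to a minimal sublinear functional. *)

(** * Sublinear functionals and minimal ones among them *)

Section Sublinear.
Context {R : realType} {V : lmodType R}.
Implicit Types (p q : V -> R) (K : set V).

(** Homogeneity is asked as an inequality because that form passes to infima; [sublinearZ] recovers
    the equality. *)
Definition sublinear q :=
  (forall x y, q (x + y) <= q x + q y) /\
  (forall t x, 0 <= t -> q (t *: x) <= t * q x).

Lemma sublinear0 q : sublinear q -> q 0 = 0.
Proof.
move=> [qD qZ]; apply/eqP; rewrite eq_le.
have := qZ 0 0 (lexx 0); rewrite scale0r mul0r => -> /=.
by have := qD 0 0; rewrite addr0 -lerBlDl subrr.
Qed.

Lemma sublinearZ q : sublinear q -> forall t x, 0 <= t -> q (t *: x) = t * q x.
Proof.
move=> qs t x; rewrite le_eqVlt => /orP[/eqP <-|t0].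
  by rewrite scale0r mul0r sublinear0.
apply/eqP; rewrite eq_le qs.2 ?(ltW t0)//= -ler_pdivlMl//.
have := qs.2 t^-1 (t *: x); rewrite scalerA mulVf ?gt_eqF// scale1r.
by apply; rewrite invr_ge0 ltW.
Qed.

Lemma sublinear_geN q : sublinear q -> forall x, - q (- x) <= q x.
Proof.
by move=> qs x; have := qs.1 (- x) x; rewrite addNr sublinear0//; lra.
Qed.

Definition convex_comb_closed K := forall x y (a : R),
  K x -> K y -> 0 <= a <= 1 -> K (a *: x + (1 - a) *: y).

(** Normalising the weights by [t + s] gives [m]. This merges two witnesses into one in the
    subadditivity of [sublinear_lower]. *)
Lemma convex_comb_cone K : convex_comb_closed K ->
  forall k l (t s : R), K k -> K l -> 0 <= t -> 0 <= s ->
  exists2 m, K m & (t + s) *: m = t *: k + s *: l.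
Proof.
move=> cK k l t s Kk Kl t0 s0; have [ts0|ts0] := eqVneq (t + s) 0.
  have [-> ->] : t = 0 /\ s = 0 by split; lra.
  by exists k => //; rewrite addr0 !scale0r addr0.
have tsp : 0 < t + s by rewrite lt_neqAle eq_sym ts0 addr_ge0.
exists (t / (t + s) *: k + (1 - t / (t + s)) *: l).
  by apply: cK => //; rewrite divr_ge0 ?addr_ge0//= ler_pdivrMr// mul1r lerDl.
by rewrite scalerDr !scalerA mulrBr mulr1 mulrCA divff// mulr1 addrAC subrr add0r.
Qed.

(** The witness is [q' x = inf (q (x + t *: k) - t * d)] over [0 <= t] and [k] in [K]. It is finite
    because [d <= q] on [K] bounds these values below by [- q (- x)]; taking [t = 1] at [- k] gives
    the last claim. *)
Lemma sublinear_lower q K (d : R) : sublinear q -> K !=set0 ->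
  convex_comb_closed K -> (forall k, K k -> d <= q k) ->
  exists q', [/\ sublinear q', forall x, q' x <= q x &
    forall k, K k -> q' (- k) <= - d].
Proof.
move=> qs [k0 Kk0] cK dq.
pose E x := [set q (x + u.1 *: u.2) - u.1 * d | u in [set u : R * V |
  0 <= u.1 /\ K u.2]].
have E0 x : E x !=set0 by exists (q (x + 0 *: k0) - 0 * d), (0, k0).
have Elb x : has_lbound (E x).
  exists (- q (- x)) => _ [[t k]/= [t0 Kk] <-].
  have := qs.1 (x + t *: k) (- x); rewrite addrAC subrr add0r sublinearZ//.
  have := ler_wpM2l t0 (dq _ Kk); lra.
have infle x t k : 0 <= t -> K k -> inf (E x) <= q (x + t *: k) - t * d.
  by move=> t0 Kk; apply: ge_inf => //; exists (t, k).
exists (fun x => inf (E x)); split; last 2 first.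
- by move=> x; have := infle x 0 k0 (lexx 0) Kk0; rewrite scale0r mul0r addr0 subr0.
- move=> k Kk; have := infle (- k) 1 k ler01 Kk.
  by rewrite scale1r addNr sublinear0// mul1r sub0r.
split=> [x y|t x t0].
  rewrite -lerBlDr; apply: lb_le_inf => // _ [[t k]/= [t0 Kk] <-].
  rewrite lerBlDr -lerBlDl; apply: lb_le_inf => // _ [[s l]/= [s0 Kl] <-].
  have [m Km tsm] := convex_comb_cone cK Kk Kl t0 s0.
  have := infle (x + y) _ m (addr_ge0 t0 s0) Km.
  rewrite tsm addrACA.
  have := qs.1 (x + t *: k) (y + s *: l); lra.
have Zle s k : 0 <= s -> K k ->
    inf (E (t *: x)) <= t * (q (x + s *: k) - s * d).
  move=> s0 Kk; apply: le_trans (infle _ _ _ (mulr_ge0 t0 s0) Kk) _.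
  by rewrite -scalerA -scalerDr sublinearZ// mulrBr mulrA.
move: t0; rewrite le_eqVlt => /orP[/eqP t0|t0].
  by have := Zle 0 k0 (lexx 0) Kk0; rewrite -t0 !mul0r.
rewrite -ler_pdivrMl//; apply: lb_le_inf => // _ [[s l]/= [s0 Kl] <-].
by rewrite ler_pdivrMl// Zle.
Qed.

(** Zorn's lemma for the reversed pointwise order: a chain is bounded by its pointwise infimum,
    finite since every member is at least [- p (- x)] at [x]. *)
Lemma exists_minimal_sublinear p : sublinear p ->
  exists q, [/\ sublinear q, forall x, q x <= p x &
    forall r, sublinear r -> (forall x, r x <= q x) -> r = q].
Proof.
move=> ps; pose T := {q : V -> R | sublinear q /\ forall x, q x <= p x}.
pose le (s t : T) := `[< forall x, sval t x <= sval s x >].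
have [| | | |[q [qs qp]] qmin] := @Zorn T le.
- by move=> t; apply/asboolP.
- move=> r s t /asboolP rs /asboolP st; apply/asboolP => x.
  exact: le_trans (st x) (rs x).
- move=> [s sP] [t tP] /asboolP/= st /asboolP/= ts; apply: eq_exist.
  by apply/funext => x; apply/eqP; rewrite eq_le st ts.
- move=> A Atot; have [[a Aa]|/set0P/negP/negPn/eqP A0] := pselect (A !=set0);
    last by exists (exist _ p (conj ps (fun x => lexx (p x)))) => s; rewrite A0.
  pose E x := [set sval s x | s in A].
  have E0 x : E x !=set0 by exists (sval a x), a.
  have Elb x : has_lbound (E x).
    exists (- p (- x)) => _ [[s [/= ss sp]] _ <-] /=.
    by apply: le_trans _ (sublinear_geN ss x); rewrite lerN2.
  have infle x s : A s -> inf (E x) <= sval s x.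
    by move=> As; apply: ge_inf => //; exists s.
  suff infs : sublinear (fun x => inf (E x)) /\ forall x, inf (E x) <= p x.
    exists (exist (fun q => sublinear q /\ forall x, q x <= p x) _ infs) => s As.
    by apply/asboolP => x /=; exact: infle.
  split; last by move=> x; apply: le_trans (infle _ _ Aa) _; exact: (svalP a).2.
  split=> [x y|t x t0].
    rewrite -lerBlDr; apply: lb_le_inf => // _ [s As <-].
    rewrite lerBlDr -lerBlDl; apply: lb_le_inf => // _ [r Ar <-].
    rewrite lerBlDl.
    (* Of the two members, the smaller one serves for both arguments. *)
    have [/asboolP sr|/asboolP rs] := Atot _ _ As Ar.
      apply: le_trans (infle _ _ Ar) _.
      by apply: le_trans ((svalP r).1.1 x y) _; rewrite lerD2r.
    apply: le_trans (infle _ _ As) _.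
    by apply: le_trans ((svalP s).1.1 x y) _; rewrite lerD2l.
  have Zle s : A s -> inf (E (t *: x)) <= t * sval s x.
    by move=> As; apply: le_trans (infle _ _ As) _; exact: (svalP s).1.2.
  move: t0; rewrite le_eqVlt => /orP[/eqP t0|t0].
    by have := Zle a Aa; rewrite -t0 !mul0r.
  rewrite -ler_pdivrMl//; apply: lb_le_inf => // _ [s As <-].
  by rewrite ler_pdivrMl// Zle.
exists q; split => // r rs rq.
have rp : sublinear r /\ forall x, r x <= p x.
  by split => // x; exact: le_trans (rq x) (qp x).
by have /(congr1 sval) := qmin (exist _ r rp) (introT (asboolP _) rq).
Qed.

(* A minimal sublinear functional is odd, since lowering it at [- y] to
   [- q y] is always possible. *)
Lemma minimal_sublinear_linear q : sublinear q ->
  (forall r, sublinear r -> (forall x, r x <= q x) -> r = q) ->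
  linear (q : V -> R^o).
Proof.
move=> qs qmin.
have qN y : q (- y) = - q y.
  apply/eqP; rewrite eq_le; apply/andP; split; last first.
    by have := sublinear_geN qs (- y); rewrite opprK.
  have [|x z a -> -> _|_ ->//|r [rs rq /(_ y erefl)]]
    := @sublinear_lower q [set y] (q y) qs.
  - by exists y.
  - by rewrite /= -scalerDl addrC subrK scale1r.
  - by rewrite (qmin r).
have qD x y : q (x + y) = q x + q y.
  apply/eqP; rewrite eq_le qs.1/=.
  by have := qs.1 (x + y) (- y); rewrite addrK qN; lra.
move=> a x y; rewrite qD; congr (_ + _).
have [a0|/ltW a0] := leP 0 a; first exact: sublinearZ.
by rewrite -[in LHS](opprK a) scaleNr qN sublinearZ ?oppr_ge0// mulNr opprK.
Qed.

End Sublinear.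

(** * Hahn-Banach separation for the norm *)

Lemma convex_setP (R : realType) (V : lmodType R) (A : set V) :
  convex_set A <-> convex_comb_closed A.
Proof.
split=> [cA x y a Ax Ay a01|cA x y l].
  have := cA x y (Itv01 (proj1 (andP a01)) (proj2 (andP a01)))
    (mem_set Ax) (mem_set Ay).
  by rewrite inE.
rewrite !inE => Ax Ay; apply: cA => //; exact/andP.
Qed.

Lemma linear_dominated_dual (R : realType) (X : normedModType R)
    (q : X -> R^o) : linear q -> (forall x, q x <= `|x|) ->
  exists g : dual X, (forall x, g x = q x) /\ forall x, `|g x| <= `|x|.
Proof.
move=> ql qle.
pose g : {linear X -> R^o} := HB.pack q (GRing.isLinear.Build R X R^o *:%R q ql).
have gle (x : X) : `|g x| <= `|x|.
  by rewrite ler_norml lerNl -linearN -{1}(normrN x) !qle.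
have gc : continuous g.
  apply: bounded_linear_continuous; apply/bounded_funP => r; exists r => x.
  exact: le_trans.
by exists (Dual gc).
Qed.

(** Lower the norm so that it is at most [- d] on [- K], then take a minimal sublinear functional
    below it: it is linear, and its value at [- k] gives the bound at [k]. *)
Lemma hahn_banach_separation (R : realType) (X : normedModType R)
    (K : set X) (d : R) : K !=set0 -> convex_comb_closed K ->
  (forall k, K k -> d <= `|k|) ->
  exists g : dual X, (forall x, `|g x| <= `|x|) /\ forall k, K k -> d <= g k.
Proof.
move=> K0 cK dK.
have ns : sublinear (fun x : X => `|x|).
  split=> [x y|t x t0]; first exact: ler_normD.
  by rewrite normrZ ger0_norm.
have [p [ps pn pK]] := sublinear_lower ns K0 cK dK.
have [q [qs qp qmin]] := exists_minimal_sublinear ps.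
have [|x|g [gq gn]] := @linear_dominated_dual R X q.
- exact: minimal_sublinear_linear.
- exact: le_trans (pn x).
exists g; split => // k Kk; rewrite -[k]opprK linearN lerNr gq.
exact: le_trans (pK _ Kk).
Qed.

(** * Seminorm balls, the dual sphere and norming functionals *)

Section Dual.
Context {R : realType} {X : normedModType R}.
Implicit Types (f g h : dual X) (A B : set X).

Lemma bounded_set_le A : bounded_set A ->
  exists2 M : R, 0 < M & forall x, A x -> `|x| <= M.
Proof. by move=> /pinfty_ex_gt0[M M0 AM]; exists M. Qed.

Lemma sub_bounded_set A B : A `<=` B -> bounded_set B -> bounded_set A.
Proof.
by move=> AB; rewrite /= /bounded_near; apply: filterS => M BM x /AB; exact: BM.
Qed.

(* Restated over [R], where the [linear] lemmas produce operations of [R^o]. *)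
Lemma dualD f x y : f (x + y) = f x + f y :> R.
Proof. exact: linearD. Qed.

Lemma dualB f x y : f (x - y) = f x - f y :> R.
Proof. exact: linearB. Qed.

Lemma dualZ f (a : R) x : f (a *: x) = a * f x :> R.
Proof. exact: linearZ. Qed.

Lemma dual_bound f : exists2 M : R, 0 < M & forall x, `|f x| <= M * `|x|.
Proof.
have /linear_bounded_continuous/linear_boundedP := @dual_continuous _ _ f.
by move=> /pinfty_ex_gt0[M M0 fM]; exists M.
Qed.

Lemma dual_bounded_on f g A : bounded_set A ->
  has_ubound [set `|f x - g x| | x in A].
Proof.
move=> /bounded_set_le[M M0 AM].
have [a a0 fa] := dual_bound f; have [b b0 gb] := dual_bound g.
exists (a * M + b * M) => _ [x Ax <-].
apply: le_trans (ler_normB _ _) _; apply: lerD.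
  by apply: le_trans (fa x) _; rewrite ler_pM2l// AM.
by apply: le_trans (gb x) _; rewrite ler_pM2l// AM.
Qed.

(** Trades the strict bound on a supremum for a uniform pointwise bound [c < e]. The condition
    [0 <= c] is kept also for empty [A], where the supremum is [0]. *)
Lemma seminorm_ballP A f g (e : R) : bounded_set A -> 0 < e ->
  seminorm_ball A f e g <->
  exists2 c, 0 <= c < e & forall x, A x -> `|f x - g x| <= c.
Proof.
move=> bA e0; rewrite /seminorm_ball/seminorm_on/=.
set E := [set `|_| | _ in _]; split=> [Ee|[c /andP[c0 ce] fg]].
  exists (Num.max 0 (sup E)); first by rewrite le_max lexx gt_max e0.
  move=> x Ax; rewrite le_max; apply/orP; right.
  by apply: ub_le_sup; [exact: dual_bounded_on|exists x].
have [E0|/set0P/negP/negPn/eqP ->] := pselect (E !=set0); last by rewrite sup0.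
by apply: le_lt_trans ce; apply: ge_sup => // _ [x Ax <-]; exact: fg.
Qed.

Lemma seminorm_ball_refl A f (e : R) : bounded_set A -> 0 < e ->
  seminorm_ball A f e f.
Proof.
move=> bA e0; apply/seminorm_ballP => //; exists 0; first by rewrite lexx.
by move=> x _; rewrite subrr normr0.
Qed.

Lemma seminorm_ball_mono A B f (e d : R) : bounded_set B -> A `<=` B ->
  0 < d -> d <= e -> seminorm_ball B f d `<=` seminorm_ball A f e.
Proof.
move=> bB AB d0 de g /(seminorm_ballP _ _ bB d0)[c /andP[c0 cd] fg].
apply/seminorm_ballP; [|exact: lt_le_trans de|].
  exact: sub_bounded_set bB.
exists c; first by rewrite c0 (lt_le_trans cd).
by move=> x /AB; exact: fg.
Qed.

Lemma seminorm_ball_shift A f g (e : R) : bounded_set A -> 0 < e ->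
  seminorm_ball A g e f ->
  exists2 d, 0 < d & seminorm_ball A f d `<=` seminorm_ball A g e.
Proof.
move=> bA e0 /(seminorm_ballP _ _ bA e0)[c /andP[c0 ce] gf].
have ec : 0 < e - c by rewrite subr_gt0.
exists (e - c) => // h /(seminorm_ballP _ _ bA ec)[b /andP[b0 be] fh].
apply/seminorm_ballP => //; exists (c + b); first by rewrite addr_ge0//=; lra.
move=> x Ax; rewrite -(subrKA (f x)); apply: le_trans (ler_normD _ _) _.
by apply: lerD; [exact: gf|exact: fh].
Qed.

Lemma dual_norm_leP f (c : R) : 0 <= c ->
  dual_norm f <= c <-> forall x, `|f x| <= c * `|x|.
Proof.
move=> c0; have [M M0 fM] := dual_bound f.
rewrite /dual_norm/seminorm_on; set E := [set `|_| | _ in _].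
have ubE : has_ubound E.
  exists M => _ [x /= x1 <-]; apply: le_trans (fM x) _.
  by rewrite ler_piMr// ltW.
split=> [E1 x|fx]; last first.
  apply: ge_sup; first by exists `|f 0|, 0 => //=; rewrite /unit_ball/= normr0.
  by move=> _ [x /= x1 <-]; apply: le_trans (fx x) _; rewrite ler_piMr.
have [->|x0] := eqVneq x 0; first by rewrite linear0 !normr0 mulr0.
have nx : 0 < `|x| by rewrite normr_gt0.
have : `|f (`|x|^-1 *: x)| <= c.
  apply: le_trans E1; apply: ub_le_sup => //; exists (`|x|^-1 *: x) => //.
  by rewrite /unit_ball/= normrZ gtr0_norm ?invr_gt0// mulVf ?gt_eqF.
by rewrite linearZ/= normrM gtr0_norm ?invr_gt0// mulrC ler_pdivrMr.
Qed.

Lemma dual_unit_ballP f : dual_unit_ball X f <-> forall x, `|f x| <= `|x|.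
Proof.
rewrite /dual_unit_ball/= dual_norm_leP//.
by split=> fx x; have := fx x; rewrite mul1r.
Qed.

Lemma dual_unit_sphere_le f : dual_unit_sphere X f -> forall x, `|f x| <= `|x|.
Proof. by move=> f1; apply/dual_unit_ballP; rewrite /dual_unit_ball/= f1. Qed.

Lemma duality_mapP x f : unit_sphere X x ->
  duality_map x f <-> (forall y, `|f y| <= `|y|) /\ f x = 1.
Proof.
rewrite /unit_sphere/= => x1; split=> [[/dual_unit_sphere_le fle fx]//|[fle fx]].
split => //; rewrite /dual_unit_sphere/=; apply/eqP; rewrite eq_le.
apply/andP; split; first exact/dual_unit_ballP.
rewrite -[leLHS]normr1 -fx; apply: ub_le_sup; last first.
  by exists x => //; rewrite /unit_ball/= x1.
exists 1 => _ [y /= y1 <-]; exact: le_trans y1.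
Qed.

Lemma dual_unit_sphere_adherent f (e : R) : dual_unit_sphere X f -> 0 < e ->
  exists2 x, `|x| <= 1 & 1 - e < f x.
Proof.
rewrite /dual_unit_sphere/= => f1 e0; have := f1.
rewrite /dual_norm/seminorm_on; set E := [set `|_| | _ in _] => E1.
have hE : has_sup E.
  split; first by exists `|f 0|, 0 => //=; rewrite /unit_ball/= normr0.
  exists 1 => _ [y /= y1 <-]; apply: le_trans y1.
  exact: dual_unit_sphere_le.
have [_ [x /= x1 <-]] := sup_adherent e0 hE; rewrite E1 => fx.
have [f0|/ltW f0] := leP 0 (f x).
  by exists x => //; rewrite ger0_norm in fx.
by exists (- x); rewrite ?normrN// linearN; rewrite ler0_norm in fx.
Qed.

(** Separating at the exact distance [inf E] from [0] to [A], rather than at [d], forces norm one: a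
    norm below [c < 1] would push all of [A] out to distance [inf E / c]. *)
Lemma hahn_banach_sphere A (d : R) : A !=set0 -> convex_comb_closed A ->
  0 < d -> (forall x, A x -> d <= `|x|) ->
  exists2 f, dual_unit_sphere X f & forall x, A x -> d <= f x.
Proof.
move=> [x0 Ax0] cA d0 dA; pose E := [set `|x| | x in A].
have E0 : E !=set0 by exists `|x0|, x0.
have dE : d <= inf E by apply: lb_le_inf => // _ [x Ax <-]; exact: dA.
have Ele x : A x -> inf E <= `|x|.
  by move=> Ax; apply: ge_inf; [exists d => _ [y Ay <-]; exact: dA|exists x].
have [|f [f1 fE]] := hahn_banach_separation _ cA Ele; first by exists x0.
exists f; last by move=> x /fE; exact: le_trans.
rewrite /dual_unit_sphere/=; apply/eqP; rewrite eq_le.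
apply/andP; split; first exact/dual_unit_ballP.
have Epos : 0 < inf E := lt_le_trans d0 dE.
rewrite leNgt; apply/negP => n1.
(* The term [2^-1] keeps [c] positive, so that division by it is allowed. *)
pose c := Num.max (dual_norm f) 2^-1.
have c0 : 0 < c by rewrite lt_max orbC invr_gt0 ltr0n.
have c1 : c < 1 by rewrite gt_max n1 invf_lt1 ?ltr1n.
have /dual_norm_leP fc : dual_norm f <= c by rewrite le_max lexx.
have : inf E / c <= inf E.
  apply: lb_le_inf => // _ [x Ax <-]; rewrite ler_pdivrMr// mulrC.
  apply: le_trans (fE x Ax) _; apply: le_trans (ler_norm _) _.
  exact: fc (ltW c0) x.
by rewrite ler_pdivrMr// ler_pMr// leNgt c1.
Qed.

Lemma dual_unit_sphere_nonempty f : dual_unit_sphere X f ->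
  exists x, unit_sphere X x.
Proof.
move=> f1; have [x _] := dual_unit_sphere_adherent f1 ltr01.
rewrite subrr => fx; have x0 : x != 0.
  by apply/eqP => x0; move: fx; rewrite x0 linear0 ltxx.
exists (`|x|^-1 *: x); rewrite /unit_sphere/= normrZ gtr0_norm ?invr_gt0 ?normr_gt0//.
by rewrite mulVf// normr_eq0.
Qed.

Lemma norming_functional (x : X) :
  exists g : dual X, (forall y, `|g y| <= `|y|) /\ g x = `|x|.
Proof.
have [|y z a -> ->|_ ->//|g [gle gx]] := @hahn_banach_separation _ _ [set x] `|x|.
- by exists x.
- by rewrite /= -scalerDl addrC subrK scale1r.
- exists g; split => //; apply/eqP; rewrite eq_le gx// andbT.
  exact: le_trans (ler_norm _) (gle x).
Qed.

Lemma duality_map_nonempty x : unit_sphere X x -> duality_map x !=set0.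
Proof.
move=> x1; have [g [gle gx]] := norming_functional x.
by exists g; apply/duality_mapP => //; rewrite gx x1.
Qed.

(** * Neighbourhoods and closures in the topology of uniform convergence on [C] *)

Section Tau.
Variable C : set (set X).
Hypothesis hC : compatible_class C.

Lemma nbhs_seminorm_ball (f : tau_dual C) A (e : R) : C A -> 0 < e ->
  nbhs f (seminorm_ball A f e : set (tau_dual C)).
Proof.
move=> CA e0; rewrite nbhsE; exists (seminorm_ball A f e) => //; split.
  exists [set (seminorm_ball A f e : set (tau_dual C))]; last exact: bigcup_set1.
  by move=> _ ->; apply: (@finI_from1 _ _ (tau_subbase (C := C)) id); exists A, f, e.
exact: seminorm_ball_refl (compatible_bounded hC CA) e0.
Qed.

(** The sets on the right form a filter, so it is enough to treat a single subbasic set. The case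
    [setT] is there for an empty class [C], which has no seminorm ball. *)
Lemma nbhs_tauP (f : tau_dual C) (U : set (tau_dual C)) : nbhs f U ->
  U = setT \/ exists A (e : R), [/\ C A, 0 < e & seminorm_ball A f e `<=` U].
Proof.
pose F : set_system (tau_dual C) := [set V | V = setT \/
  exists A (e : R), [/\ C A, 0 < e & seminorm_ball A f e `<=` V]].
have FF : Filter F.
  split; first by left.
  - move=> V W [->|[A [e [CA e0 AV]]]] [->|[B [d [CB d0 BW]]]].
    + by left; rewrite setTI.
    + by right; exists B, d; rewrite setTI.
    + by right; exists A, e; rewrite setIT.
    right; exists (A `|` B), (Num.min e d).
    have CAB := compatible_setU hC CA CB.
    have bAB := compatible_bounded hC CAB.
    split => //; first by rewrite lt_min e0.
    move=> g ABg; split; [apply: AV|apply: BW]; apply: seminorm_ball_mono ABg => //.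
    + by rewrite lt_min e0.
    + by rewrite ge_min lexx.
    + by rewrite lt_min e0.
    + by rewrite ge_min lexx orbT.
  - move=> V W VW [VT|[A [e [CA e0 AV]]]]; [left|right].
      by apply/seteqP; split => // x _; apply: VW; rewrite VT.
    by exists A, e; split => //; exact: subset_trans VW.
rewrite nbhsE => -[B [oB Bf] BU]; suff : F U by [].
move: oB Bf BU => [D Dsub <-] [V DV Vf] BU.
apply: (@filterS _ F _ V); first by move=> g Vg; apply: BU; exists V.
move: (Dsub _ DV) Vf => [E Esub <-] Ef.
apply: filter_bigI => W EW; have : W f by exact: Ef.
have /set_mem[A [g [e [CA e0 ->]]]] := Esub _ EW.
move=> /(seminorm_ball_shift (compatible_bounded hC CA) e0)[d d0 sub].
by right; exists A, d.
Qed.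

Lemma closure_tauP (f : tau_dual C) (S : set (tau_dual C)) : S !=set0 ->
  closure S f <-> forall A (e : R), C A -> 0 < e ->
    S `&` seminorm_ball A f e !=set0.
Proof.
move=> [s Ss]; split=> [clS A e CA e0|SA U /nbhs_tauP[->|[A [e [CA e0 AU]]]]].
- exact/clS/nbhs_seminorm_ball.
- by exists s.
- by have [g [Sg /AU Ug]] := SA _ _ CA e0; exists g.
Qed.

End Tau.
End Dual.

(** * Second differences of the norm against w*-slices *)

Section Implications.
Context {R : realType} {X : normedModType R}.
Implicit Types (f g h : dual X) (A B : set X).

(** Boundedness of [A] bounds the quotients by [2 * M], so the supremum in [d1] really dominates
    each of them. *)
Lemma M_setP A (e : R) x : bounded_set A -> 0 < e ->
  M_set e A x <-> `|x| = 1 /\ exists d c : R, [/\ 0 < d, 0 <= c < e &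
    forall l y, 0 < l < d -> A y -> `|x + l *: y| + `|x - l *: y| - 2 <= c * l].
Proof.
move=> /bounded_set_le[M M0 AM] e0.
pose E d := [set (`|x + l *: y| + `|x - l *: y| - 2) / l |
       l in [set l | 0 < l < d] & y in A].
split=> [[d /= d0 [x1 dE]]|[x1 [d [c [d0 /andP[c0 ce] dc]]]]]; last first.
  exists d => //; split => //; rewrite /d1 -/(E d).
  have [E0|/set0P/negP/negPn/eqP ->] := pselect (E d !=set0); last by rewrite sup0.
  apply: le_lt_trans ce; apply: ge_sup => // _ [l /= ld [y Ay <-]].
  by rewrite ler_pdivrMr; [exact: dc|case/andP: ld].
split => //.
have ubE : has_ubound (E d).
  exists (2 * M) => _ [l /= /andP[l0 ld] [y Ay <-]].
  rewrite ler_pdivrMr//.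
  have := ler_normD x (l *: y); have := ler_normB x (l *: y).
  have := ler_wpM2l (ltW l0) (AM _ Ay).
  rewrite normrZ gtr0_norm// x1; lra.
exists d, (Num.max 0 (sup (E d))); split => //.
  by rewrite le_max lexx gt_max e0.
move=> l y ld Ay; have l0 : 0 < l by case/andP: ld.
rewrite -ler_pdivrMr// le_max; apply/orP; right.
by apply: ub_le_sup => //; exists l => //; exists y.
Qed.

Lemma M_set_mono A B (d e : R) : bounded_set B -> A `<=` B -> 0 < d -> d <= e ->
  M_set d B `<=` M_set e A.
Proof.
move=> bB AB d0 de x /(M_setP _ bB d0)[x1 [r [c [r0 /andP[c0 cd] rc]]]].
apply/M_setP; [exact: sub_bounded_set bB|exact: lt_le_trans de|split => //].
exists r, c; split => //; first by rewrite c0 (lt_le_trans cd).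
by move=> l y lr /AB; exact: rc.
Qed.

(** Adding [g (x + l *: y)] and [h (x - l *: y)] gives at most [2 + c * l], while
    [g x + h x > 2 - 2 * t]; hence [l * (g y - h y)] is below [c * l + 2 * t]. *)
Lemma M_set_slice A (e : R) x : bounded_set A -> 0 < e -> M_set e A x ->
  exists2 t : R, 0 < t < 1 & forall g h, weak_star_slice x t g ->
    weak_star_slice x t h -> forall y, A y -> `|g y - h y| <= 2 * e.
Proof.
move=> bA e0 /(M_setP _ bA e0)[x1 [r [c [r0 /andP[c0 ce] rc]]]].
pose l := r / 2; have l0 : 0 < l by rewrite divr_gt0.
have lr : 0 < l < r by rewrite l0 /= /l; lra.
(* The second term makes [2 * t <= e * l]; the first keeps [t] below [1]. *)
pose t := Num.min 2^-1 (e * l / 2).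
have t0 : 0 < t by rewrite lt_min invr_gt0 ltr0n/= divr_gt0// mulr_gt0.
have t1 : t < 1 by rewrite gt_min invf_lt1 ?ltr1n.
have tl : 2 * t <= e * l.
  by rewrite mulrC -ler_pdivlMr// ge_min lexx orbT.
exists t; first by rewrite t0.
suff gh_le g h : weak_star_slice x t g -> weak_star_slice x t h ->
    forall y, A y -> g y - h y <= 2 * e.
  move=> g h gt ht y Ay; rewrite ler_norml gh_le// andbT lerNl opprB.
  exact: gh_le.
move=> [/dual_unit_ballP gle gt] [/dual_unit_ballP hle ht] y Ay.
have := le_trans (ler_norm _) (gle (x + l *: y)).
have := le_trans (ler_norm _) (hle (x - l *: y)).
rewrite (dualD g) (dualB h) !dualZ.
rewrite -(ler_pM2l l0 (g y - h y)).
have := rc l y lr Ay; have : c * l <= e * l by rewrite ler_pM2r// ltW.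
lra.
Qed.

(* The norming functionals of [x + l y] and [x - l y]
   bound the second difference by [l |g y - h y|]. *)
Lemma norming_oscillation_M_set A (c e r : R) x : bounded_set A -> 0 <= c < e ->
  unit_sphere X x -> 0 < r ->
  (forall g h u v, `|x - u| < r -> `|x - v| < r -> dual_unit_ball X g ->
    dual_unit_ball X h -> g u = `|u| -> h v = `|v| ->
    forall y, A y -> `|g y - h y| <= c) ->
  M_set e A x.
Proof.
move=> bA /andP[c0 ce] x1 r0 osc; apply/M_setP => //; first exact: le_lt_trans ce.
have [M M0 AM] := bounded_set_le bA.
(* For [l < r / M] both [x + l *: y] and [x - l *: y] stay within [r] of [x]. *)
split => //; exists (r / M), c; split; [exact: divr_gt0|by rewrite c0|].
move=> l y /andP[l0]; rewrite ltr_pdivlMr// => lM Ay.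
have ly : `|l *: y| < r.
  by apply: le_lt_trans lM; rewrite normrZ gtr0_norm// ler_pM2l// AM.
have [g [gle gu]] := norming_functional (x + l *: y).
have [h [hle hv]] := norming_functional (x - l *: y).
have := osc g h (x + l *: y) (x - l *: y).
rewrite opprD addNKr opprB subrKC normrN => /(_ ly ly).
move=> /(_ (proj2 (dual_unit_ballP _) gle) (proj2 (dual_unit_ballP _) hle) gu hv).
move=> /(_ y Ay) /(le_trans (ler_norm _)).
rewrite -(ler_pM2l l0 (g y - h y)) -gu -hv (dualD g) (dualB h) !dualZ.
have := le_trans (ler_norm _) (gle x).
have := le_trans (ler_norm _) (hle x).
rewrite x1; lra.
Qed.

Lemma near_duality_slice x z (t : R) h : `|x - z| < t -> unit_sphere X z ->
  duality_map z h -> weak_star_slice x t h.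
Proof.
move=> xz z1 /(duality_mapP _ z1)[hle hz]; split; first exact/dual_unit_ballP.
have := le_trans (ler_norm _) (hle (z - x)).
rewrite dualB hz distrC; lra.
Qed.

Lemma duality_slice x (t : R) h : 0 < t -> unit_sphere X x ->
  duality_map x h -> weak_star_slice x t h.
Proof. by move=> t0; apply: near_duality_slice; rewrite subrr normr0. Qed.

End Implications.

(** * Semidenting points, density of duality images, quasicontinuity and support mappings *)

Section Characterizations.
Context {R : realType} {X : normedModType R} (C : set (set X)).
Hypothesis hC : compatible_class C.
Implicit Types (f g h : dual X) (A B : set X).

(* Condition (c) with a single member of [C] governing both the points and the
   neighbourhoods; the equivalence of (b), (c) and (d) goes through it. *)
Definition duality_M_approx := forall f A (e : R), dual_unit_sphere X f ->
  C A -> 0 < e -> exists x g, [/\ M_set e A x, duality_map x g &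
    seminorm_ball A f e g].

Definition M_images_tau_dense := forall (e : R) A, 0 < e -> C A ->
  tau_dense C (dual_unit_sphere X) (duality_image (M_set e A)).

Definition sphere_semidenting := forall f, dual_unit_sphere X f ->
  strong_semidenting C f.

Definition support_mappings_preserve_density :=
  forall phi : X -> dual X, support_mapping phi ->
  forall A, dense_in (unit_sphere X) A ->
  tau_dense C (dual_unit_sphere X) (phi @` A).

Let bC A : C A -> bounded_set A := @compatible_bounded _ _ _ hC A.

(** The set defining [M_set] and the one defining the neighbourhood are merged into their union,
    with the smaller tolerance; both memberships survive by monotonicity. *)
Lemma duality_M_approx_tau_dense : duality_M_approx -> M_images_tau_dense.
Proof.
move=> app e A e0 CA; split=> [g [x _ []]//|f f1].
have [x [g [Mx xg _]]] := app f A e f1 CA e0.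
apply/(closure_tauP hC); first by exists g, x.
move=> B d CB d0; have CAB := compatible_setU hC CA CB.
have m0 : 0 < Num.min e d by rewrite lt_min e0.
have [z [h [Mz zh fh]]] := app f _ _ f1 CAB m0.
exists h; split; last first.
  apply: seminorm_ball_mono fh => //; first exact: bC.
  by rewrite ge_min lexx orbT.
exists z => //; apply: M_set_mono Mz => //; first exact: bC.
by rewrite ge_min lexx.
Qed.

Lemma tau_dense_duality_M_approx : M_images_tau_dense -> duality_M_approx.
Proof.
move=> dense f A e f1 CA e0.
have [_ /(_ f f1) clf] := dense e A e0 CA.
have := clf _ (nbhs_seminorm_ball hC f CA e0).
by move=> [g [[x Mx xg] fg]]; exists x, g.
Qed.

(** Functionals norming points close to the slice direction [x] lie in the slice, hence within
    [e / 4] of [f] on [A], so they oscillate by at most [e / 2]. *)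
Lemma semidenting_duality_M_approx : sphere_semidenting -> duality_M_approx.
Proof.
move=> sd f A e f1 CA e0; have bA := bC CA.
have e4 : 0 < e / 4 by rewrite divr_gt0.
have [x [d [x1 /andP[d0 d1] sub]]] := sd f f1 A _ CA e4.
have [g xg] := duality_map_nonempty x1; exists x, g; split => //; last first.
  apply: (@seminorm_ball_mono _ _ A A f e (e / 4)) => //; first by lra.
  exact/sub/duality_slice.
apply: (@norming_oscillation_M_set _ _ _ (e / 2) e (d / 2)) => //.
- by apply/andP; split; lra.
- by rewrite divr_gt0.
(* One half of [d] pays for [1 - |w|], the other for [k (w - x)]. *)
have near_slice k w : `|x - w| < d / 2 -> dual_unit_ball X k -> k w = `|w| ->
    weak_star_slice x d k.
  move=> xw k1 kw; split => //; have /dual_unit_ballP kle := k1.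
  have := le_trans (ler_norm _) (kle (w - x)).
  have := ler_normD w (x - w); rewrite subrKC x1 dualB kw (distrC w x); lra.
move=> h k u v xu xv h1 k1 hu kv y Ay.
have /sub/(seminorm_ballP _ _ bA e4)[a /andP[_ ae] ha] := near_slice h u xu h1 hu.
have /sub/(seminorm_ballP _ _ bA e4)[b /andP[_ be] kb] := near_slice k v xv k1 kv.
rewrite -(subrKA (f y)); apply: le_trans (ler_normD _ _) _.
by rewrite distrC; have := ha y Ay; have := kb y Ay; lra.
Qed.

Lemma duality_M_approx_slice : duality_M_approx -> forall f A (e : R),
  dual_unit_sphere X f -> C A -> 0 < e -> exists x (t : R),
  [/\ unit_sphere X x, 0 < t < 1 & weak_star_slice x t `<=` seminorm_ball A f e].
Proof.
move=> app f A e f1 CA e0; have bA := bC CA.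
have e4 : 0 < e / 4 by rewrite divr_gt0.
have [x [g [Mx xg fg]]] := app f A _ f1 CA e4.
have x1 : unit_sphere X x by have [] := proj1 (M_setP _ bA e4) Mx.
have [t t01 osc] := M_set_slice bA e4 Mx.
have t0 : 0 < t by case/andP: t01.
exists x, t; split => // h ht; apply/seminorm_ballP => //.
have [c /andP[c0 ce] fgc] := proj1 (seminorm_ballP _ _ bA e4) fg.
(* [c < e / 4] compares [f] with [g], and twice [e / 4] is the oscillation over the slice. *)
exists (c + 2 * (e / 4)); first by apply/andP; split; lra.
move=> y Ay; rewrite -(subrKA (g y)); apply: le_trans (ler_normD _ _) _.
by apply: lerD; [exact: fgc|exact: osc (duality_slice t0 x1 xg) ht y Ay].
Qed.

Lemma duality_M_approx_quasicontinuous :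
  duality_M_approx -> norm_tau_quasicontinuous C.
Proof.
move=> app f e A f1 e0 CA.
have [x [t [x1 /andP[t0 t1] sub]]] := duality_M_approx_slice app f1 CA e0.
exists t, x; split => // h [z [z1 xz] zh]; apply: sub.
by apply: near_duality_slice zh => //; rewrite -ball_normE in xz.
Qed.

Lemma quasicontinuous_duality_M_approx :
  norm_tau_quasicontinuous C -> duality_M_approx.
Proof.
move=> qc f A e f1 CA e0; have bA := bC CA.
have e4 : 0 < e / 4 by rewrite divr_gt0.
have [d [x [d0 x1 sub]]] := qc f _ A f1 e4 CA.
have [g xg] := duality_map_nonempty x1; exists x, g; split => //; last first.
  apply: (@seminorm_ball_mono _ _ A A f e (e / 4)) => //; first by lra.
  by apply: sub; exists x => //; split => //; exact: ballxx.
(* [2^-1] keeps [w] away from [0], so it can be normalised; normalising moves [w] by at most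
   [|x - w|], so [d / 2] keeps the result within [d] of [x]. *)
pose r := Num.min 2^-1 (d / 2).
have r0 : 0 < r by rewrite lt_min invr_gt0 ltr0n divr_gt0.
have r1 : r <= 2^-1 by rewrite ge_min lexx.
have rd : r <= d / 2 by rewrite ge_min lexx orbT.
apply: (@norming_oscillation_M_set _ _ _ (e / 2) e r) => //.
  by apply/andP; split; lra.
have near_D k w : `|x - w| < r -> dual_unit_ball X k -> k w = `|w| ->
    duality_image (unit_sphere X `&` ball x d) k.
  move=> xw /dual_unit_ballP kle kw.
  have w1 : `| 1 - `|w| | <= `|x - w| by rewrite -[1]x1; exact: ler_dist_dist.
  have w0 : 0 < `|w|.
    by have := le_trans (ler_norm _) w1; lra.
  have z1 : unit_sphere X (`|w|^-1 *: w).
    by rewrite /unit_sphere/= normrZ gtr0_norm ?invr_gt0// mulVf ?gt_eqF.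
  exists (`|w|^-1 *: w); last first.
    by apply/duality_mapP => //; split => //; rewrite dualZ kw mulVf ?gt_eqF.
  split => //; rewrite -ball_normE /ball_/=.
  rewrite -(subrKA w); apply: le_lt_trans (ler_normD _ _) _.
  have -> : `|w - `|w|^-1 *: w| = `| 1 - `|w| |.
    rewrite -[X in X - _]scale1r -scalerBl normrZ -{2}(normr_id w) -normrM.
    by rewrite mulrBl mul1r mulVf ?gt_eqF// distrC.
  lra.
move=> h k u v xu xv h1 k1 hu kv y Ay.
have /sub/(seminorm_ballP _ _ bA e4)[a /andP[_ ae] ha] := near_D h u xu h1 hu.
have /sub/(seminorm_ballP _ _ bA e4)[b /andP[_ be] kb] := near_D k v xv k1 kv.
rewrite -(subrKA (f y)); apply: le_trans (ler_normD _ _) _.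
by rewrite distrC; have := ha y Ay; have := kb y Ay; lra.
Qed.

Lemma quasicontinuous_support_mappings :
  norm_tau_quasicontinuous C -> support_mappings_preserve_density.
Proof.
move=> qc phi supp A [AS SA]; split=> [_ [x /AS x1 <-]|f f1].
  by have [] := supp x x1.
have hit x (d : R) : unit_sphere X x -> 0 < d -> exists2 a, A a & ball x d a.
  by move=> x1 d0; have [a []] := SA x x1 _ (nbhsx_ballx x _ d0); exists a.
apply/(closure_tauP hC).
  have [x x1] := dual_unit_sphere_nonempty f1.
  by have [a Aa _] := hit x 1 x1 ltr01; exists (phi a), a.
move=> B e CB e0; have [d [x [d0 x1 sub]]] := qc f e B f1 e0 CB.
have [a Aa xa] := hit x d x1 d0.
exists (phi a); split; first by exists a.
by apply: sub; exists a; [split => //; exact: AS|exact/supp/AS].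
Qed.

(** If quasicontinuity fails at [f], the points [Z] having a supporting functional outside the
    seminorm ball are dense; a support mapping choosing such functionals on [Z] sends [Z] off a
    neighbourhood of [f]. *)
Lemma support_mappings_quasicontinuous :
  support_mappings_preserve_density -> norm_tau_quasicontinuous C.
Proof.
move=> pres f e A f1 e0 CA; apply: contrapT => nqc.
pose Z := [set z | unit_sphere X z /\
  exists h, duality_map z h /\ ~ seminorm_ball A f e h].
have /choice[phi phiP] (x : X) : exists h, (unit_sphere X x -> duality_map x h) /\
    (Z x -> ~ seminorm_ball A f e h).
  have [[x1 [h [xh nh]]]|nZ] := pselect (Z x); first by exists h.
  have [/duality_map_nonempty[h xh]|nx] := pselect (unit_sphere X x).
    by exists h.
  (* Off the sphere the value is arbitrary. *)
  by exists f.
have supp : support_mapping phi by move=> x; exact: (phiP x).1.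
have dZ : dense_in (unit_sphere X) Z.
  split=> [z []//|x x1 U /nbhs_ballP[d /= d0 xU]].
  apply: contrapT => nZU; apply: nqc; exists d, x; split => // h [z [z1 xz] zh].
  apply: contrapT => nh; apply: nZU; exists z; split; last exact: xU.
  by split => //; exists h.
have [_ /(_ f f1)] := pres phi supp Z dZ.
move=> /(_ _ (nbhs_seminorm_ball hC f CA e0))[_ [[z Zz <-]]].
exact: (phiP z).2.
Qed.

End Characterizations.

(** * Balls separating points from sets, and slices *)

Section BallSeparation.
Context {R : realType} {X : normedModType R} (C : set (set X)).
Hypothesis hC : compatible_class C.
Implicit Types (f g h : dual X) (A B : set X).

Lemma unit_ball_sup_le f (a b c : R) : dual_unit_sphere X f -> 0 <= b ->
  (forall y, `|y| <= 1 -> a + b * f y <= c) -> a + b <= c.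
Proof.
move=> f1 b0 fy; apply/ler_addgt0Pr => e e0.
(* Dividing by [b + 1] instead of [b] covers [b = 0]. *)
have b1 : 0 < b + 1 by lra.
have [y y1 /ltW fe] := dual_unit_sphere_adherent f1 (divr_gt0 e0 b1).
have : b * (e / (b + 1)) <= e.
  by rewrite mulrCA ger_pMr// ler_pdivrMr// mul1r; lra.
have := fy y y1; have := ler_wpM2l b0 fe; lra.
Qed.

Lemma closed_half_space f (c : R) : closed [set x | c <= f x].
Proof.
have /continuous_closedP/(_ [set r : R^o | c <= r]) := @dual_continuous _ _ f.
by apply; exact: closed_ge.
Qed.

Lemma dist_notin_closure A z : ~ closure A z ->
  exists2 d : R, 0 < d & forall x, A x -> d <= `|x - z|.
Proof.
move=> nA; apply: contrapT => nd; apply: nA => U /nbhs_ballP[d /= d0 zU].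
apply: contrapT => nU; apply: nd; exists d => // x Ax.
rewrite leNgt; apply/negP => xz; apply: nU; exists x; split => //.
by apply: zU; rewrite -ball_normE /= distrC.
Qed.

(* Separate [A + b B(X)] from [z] by [f]; functionals in a slice at [x] inside a
   small neighbourhood of [f] still separate, and only these come near to norming
   [t x - (a - z)] for large [t], so a large ball centred at [z + t x] works. *)
Lemma semidenting_strong_MIP : sphere_semidenting C -> strong_MIP C.
Proof.
move=> sd A b CA [a0 Aa0] _ /convex_setP cA b0 K.
apply/seteqP; split=> [z Kz B [_]|z zB]; first exact.
apply: contrapT => /dist_notin_closure[d d0 Ld].
pose L := [set x + b *: y - z | x in A & y in unit_ball X].
have L0 : L !=set0.
  exists (a0 + b *: 0 - z), a0 => //; exists 0 => //.
  by rewrite /unit_ball/= normr0.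
have cL : convex_comb_closed L.
  move=> _ _ t [x Ax [u u1 <-]] [y Ay [v v1 <-]] /[dup] t01 /andP[t0 t1].
  exists (t *: x + (1 - t) *: y); first exact: cA.
  exists (t *: u + (1 - t) *: v).
    rewrite /unit_ball/=; apply: le_trans (ler_normD _ _) _.
    rewrite !normrZ ger0_norm// (@ger0_norm _ (1 - t)) ?subr_ge0//.
    have := ler_wpM2l t0 u1; have t1' : 0 <= 1 - t by lra.
    have := ler_wpM2l t1' v1; lra.
  have {1}-> : - z = t *: - z + (1 - t) *: - z.
    by rewrite -scalerDl subrKC scale1r.
  rewrite !scalerDr !scalerA ![_ * b]mulrC [RHS]addrACA.
  by congr (_ + _); exact: addrACA.
have [f f1 fL] : exists2 f, dual_unit_sphere X f & forall x, L x -> d <= f x.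
  apply: hahn_banach_sphere => // _ [x Ax [y y1 <-]].
  by apply: Ld; exists x => //; exists y.
(* Since [f] has norm one, the infimum over [b B(X)] lowers [f] by exactly [b]. *)
have fA a : A a -> b + d <= f (a - z).
  move=> Aa; rewrite addrC; apply: unit_ball_sup_le f1 b0 _ => y y1.
  have : d <= f (a + b *: - y - z).
    by apply: fL; exists a => //; exists (- y) => //; rewrite /unit_ball/= normrN.
  rewrite addrAC dualD dualZ -[- y]scaleN1r dualZ; lra.
pose Az := [set 1 *: y + - z | y in A].
have CAz : C Az by exact: compatible_affine.
have AzE a : A a -> Az (a - z) by move=> Aa; exists a => //; rewrite scale1r.
have d2 : 0 < d / 2 by rewrite divr_gt0.
have bAz := compatible_bounded hC CAz.
have [x [r [x1 /andP[r0 r1] sub]]] := sd f f1 Az _ CAz d2.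
have [M M0 AzM] := bounded_set_le bAz.
(* Large enough that a functional norming a vector [t *: x - (a - z)] longer than [t - d / 4 - b]
   must lie in the slice of width [r]. *)
pose t := (b + d + M + 1) / r.
have t_gt : b + d + M + 1 < t by rewrite ltr_pdivlMr// gtr_pMr//; lra.
have tr : t * r = b + d + M + 1 by rewrite divfK// gt_eqF.
have t0 : 0 < t by lra.
have rho0 : 0 < t - d / 4 by lra.
have far a : A a -> `|t *: x - (a - z)| <= t - d / 4 - b.
  move=> Aa; rewrite leNgt; apply/negP => lt_far.
  have [g [gle gx]] := norming_functional (t *: x - (a - z)).
  move: (gx); rewrite dualB dualZ => gxE.
  have gM : - M <= g (a - z).
    by have := gle (a - z); have := AzM _ (AzE _ Aa); rewrite ler_norml; lra.
  have gS : weak_star_slice x r g.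
    split; first exact/dual_unit_ballP.
    by rewrite -(ltr_pM2l t0) mulrBr mulr1 tr; lra.
  have [c /andP[_ cd] fgc] := proj1 (seminorm_ballP _ _ bAz d2) (sub _ gS).
  have := le_trans (ler_norm _) (fgc _ (AzE _ Aa)).
  have := fA a Aa.
  have : t * g x <= t.
    by rewrite -[leRHS]mulr1 ler_pM2l// -x1; exact: le_trans (ler_norm _) (gle x).
  lra.
(* This is the contradiction sought: [z] is at distance [t] from the centre. *)
have : closed_ball (z + t *: x) (t - d / 4) z.
  apply: zB; split; first by exists (z + t *: x), (t - d / 4).
  rewrite /K [X in _ `<=` X](_ : _ =
    closure (closed_ball (z + t *: x) (t - d / 4)));
    last exact/closure_id/closed_ball_closed.
  apply: closure_subset => _ [a Aa [y y1 <-]].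
  rewrite closed_ballE// /closed_ball_/=.
  have -> : z + t *: x - (a + b *: y) = (t *: x - (a - z)) - b *: y.
    by rewrite opprB opprD addrA (addrC z) -(addrA (t *: x)).
  apply: le_trans (ler_normB _ _) _; rewrite normrZ ger0_norm//.
  have := far a Aa; have := ler_wpM2l b0 y1; lra.
rewrite closed_ballE// /closed_ball_/= addrC addKr normrZ gtr0_norm// x1; lra.
Qed.

Lemma closed_abs_convex_hull_sub A : A `<=` closed_abs_convex_hull A.
Proof. exact: sub_gen_smallest. Qed.

Lemma closed_closed_abs_convex_hull A : closed (closed_abs_convex_hull A).
Proof. by apply: closed_bigI => B [[]]. Qed.

Lemma closed_abs_convex_hullZ A (a : R) x : `|a| <= 1 ->
  closed_abs_convex_hull A x -> closed_abs_convex_hull A (a *: x).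
Proof. by move=> a1 Ax B BA; apply: BA.1.2.2 => //; exact: Ax. Qed.

Lemma closed_abs_convex_hull_convex A :
  convex_comb_closed (closed_abs_convex_hull A).
Proof.
move=> x y a Ax Ay a01 B BA; have /convex_setP cB := BA.1.2.1.
by apply: cB => //; [exact: Ax|exact: Ay].
Qed.

(** With [x] the direction of [x0], the bound on [t] gives [r <= g x0]. Testing the inclusion at
    [a - b *: x] then gives [g a >= b * g x]. *)
Lemma ball_inclusion_slice A (b r : R) x0 : 0 <= b -> 0 < r -> r < `|x0| ->
  (forall a y, A a -> `|y| <= 1 -> `|x0 - (a + b *: y)| <= r) ->
  exists x, unit_sphere X x /\ forall (t : R) g, t <= 1 - r / `|x0| ->
    weak_star_slice x t g -> forall a, A a -> b * (1 - t) <= g a.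
Proof.
move=> b0 r0 rx AB; have nx : 0 < `|x0| := lt_trans r0 rx.
have x1 : `| `|x0|^-1 *: x0 | = 1.
  by rewrite normrZ gtr0_norm ?invr_gt0// mulVf ?gt_eqF.
exists (`|x0|^-1 *: x0); split => // t g tr [/dual_unit_ballP gle gt] a Aa.
have : r <= `|x0| * g (`|x0|^-1 *: x0).
  have : r / `|x0| <= g (`|x0|^-1 *: x0) by lra.
  by rewrite ler_pdivrMr// mulrC.
rewrite -dualZ scalerA mulfV ?gt_eqF// scale1r => rg.
have := AB a (- (`|x0|^-1 *: x0)) Aa; rewrite normrN x1 => /(_ (lexx _)).
move=> /(le_trans (gle _))/(le_trans (ler_norm _)).
rewrite dualB dualD dualZ -[- (_ *: x0)]scaleN1r dualZ.
have := ler_wpM2l b0 (ltW gt); lra.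
Qed.

(* Take [u] in the unit ball with [f u] close to [1]. A ball containing
   [A' + M B(X)] but not [0], with [A'] a set of points [a + s u] on which [f] is
   slightly larger than [M], gives a slice of functionals at least about [M] on
   [A']; moving [a] along [u] up to that level compares [g a] with [f a]. *)
Lemma strong_MIP_semidenting : strong_MIP C -> sphere_semidenting C.
Proof.
move=> mip f f1 A e CA e0; have bA := compatible_bounded hC CA.
have [M M0 AM] := bounded_set_le bA.
have fle := dual_unit_sphere_le f1.
pose n := e / 8; have n0 : 0 < n by rewrite divr_gt0.
(* Chosen so that [(2 * M + n) * k = n]: the error factor [v^-1 - 1 < k] then costs at most [n]. *)
pose k := n / (2 * M + n); have k0 : 0 < k by rewrite divr_gt0//; lra.
have th0 : 0 < 1 - (1 + k)^-1 by rewrite subr_gt0 invf_lt1; lra.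
have [u u1] := dual_unit_sphere_adherent f1 th0.
rewrite subKr => kv; set v := f u in kv.
have v0 : 0 < v by apply: lt_trans kv; rewrite invr_gt0; lra.
have vk : v^-1 < 1 + k by rewrite invf_plt ?posrE//; lra.
have vi0 : 0 < v^-1 by rewrite invr_gt0.
(* The largest shift along [u] ever needed, reached when [f a = - M]. *)
pose c := (2 * M + n) / v.
have c0 : 0 < c by rewrite divr_gt0//; lra.
pose H := closed_abs_convex_hull (A `|` [set c *: u]).
have CH : C H by apply: compatible_hull => //; exact: compatible_setU1.
have HA a : A a -> H a by move=> Aa; apply: closed_abs_convex_hull_sub; left.
have Hu : H (c *: u) by apply: closed_abs_convex_hull_sub; right.
(* Doubling the hull makes room for [s a *: u + a], whose half is the midpoint of two points of
   [H]. *)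
pose A' := [set w | H (2^-1 *: w) /\ M + n <= f w].
have CA' : C A'.
  apply: (compatible_subset hC (compatible_affine hC 2 0 CH)) => w [Hw _].
  by exists (2^-1 *: w) => //; rewrite addr0 scalerA divff ?pnatr_eq0// scale1r.
have clA' : closed A'.
  apply: closedI; last exact: closed_half_space.
  have /continuous_closedP/(_ H) := @scaler_continuous R X 2^-1.
  by apply; exact: closed_closed_abs_convex_hull.
have cA' : convex_set A'.
  apply/convex_setP => x y a [Hx fx] [Hy fy] /[dup] a01 /andP[a0 a1]; split.
    rewrite scalerDr !scalerA ![2^-1 * _]mulrC -!scalerA.
    exact: closed_abs_convex_hull_convex.
  rewrite dualD !dualZ; have a1' : 0 <= 1 - a by lra.
  have := ler_wpM2l a0 fx; have := ler_wpM2l a1' fy; lra.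
pose s a := (M + n - f a) / v.
have lift a : H a -> `|a| <= M -> [/\ A' (s a *: u + a), 0 <= s a &
    f a + s a - M <= n + n].
  move=> Ha aM; have := le_trans (fle a) aM; rewrite ler_norml => /andP[faN faM].
  have s0 : 0 <= s a by rewrite divr_ge0 ?(ltW v0)//; lra.
  have sc : s a <= c by rewrite ler_pM2r//; lra.
  have fs : f (s a *: u + a) = M + n :> R.
    by rewrite dualD dualZ divfK ?gt_eqF// subrK.
  split => //.
    split; last by rewrite fs.
    have -> : 2^-1 *: (s a *: u + a) =
        2^-1 *: ((s a / c) *: (c *: u)) + (1 - 2^-1) *: a.
      rewrite scalerDr !scalerA divfK ?gt_eqF//.
      by congr (_ + _ *: _); lra.
    apply: closed_abs_convex_hull_convex => //; last by apply/andP; split; lra.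
    apply: closed_abs_convex_hullZ => //.
    have sc0 : 0 <= s a / c by apply: divr_ge0 => //; exact: ltW.
    by rewrite ger0_norm// ler_pdivrMr// mul1r.
  have : (M + n - f a) * (v^-1 - 1) <= n.
    have kE : (2 * M + n) * k = n by rewrite mulrC divfK// gt_eqF//; lra.
    rewrite -[leRHS]kE; apply: (@le_trans _ _ ((M + n - f a) * k)).
      by apply: ler_wpM2l; lra.
    by apply: ler_wpM2r; lra.
  rewrite /s mulrBr; lra.
(* [0] comes from [c *: u], so [A'] is nonempty even for empty [A]. *)
have H0 : H 0.
  by rewrite -(scale0r (c *: u)); apply: closed_abs_convex_hullZ; rewrite ?normr0.
have A'0 : A' !=set0.
  by exists (s 0 *: u + 0); have [] := lift 0 H0; rewrite ?normr0 ?(ltW M0).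
have := mip A' M CA' A'0 clA' cA' (ltW M0).
set K := closure _ => KE.
have nK0 : ~ K 0.
  (* Adding [M B(X)] lowers [f] by at most [M], leaving the margin [n]. *)
  have Kf : K `<=` [set x | n <= f x].
    rewrite [X in _ `<=` X](_ : _ = closure [set x | n <= f x]);
      last exact/closure_id/closed_half_space.
    apply: closure_subset => _ [a [_ fa] [y y1 <-]] /=.
    have := le_trans (fle y) y1; rewrite ler_norml => /andP[fy _].
    rewrite dualD dualZ; have := ler_wpM2l (ltW M0) fy; lra.
  by move=> /Kf/=; rewrite linear0 leNgt n0.
have [x0 [r [r0 Kr rx]]] : exists x0 (r : R),
    [/\ 0 < r, K `<=` closed_ball x0 r & r < `|x0|].
  apply: contrapT => nb; apply: nK0; rewrite KE => B [[x0 [r [r0 ->]]] KB].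
  apply: contrapT => nB; apply: nb; exists x0, r; split => //.
  rewrite ltNge; apply/negP => xr; apply: nB.
  by rewrite closed_ballE// /closed_ball_/= subr0.
have [x [x1 slice]] : exists x, unit_sphere X x /\
    forall (t : R) g, t <= 1 - r / `|x0| -> weak_star_slice x t g ->
    forall a, A' a -> M * (1 - t) <= g a.
  apply: ball_inclusion_slice => //; first exact: ltW.
  move=> a y A'a y1; have : K (a + M *: y).
    by apply: subset_closure; exists a => //; exists y.
  by move=> /Kr; rewrite closed_ballE.
pose t := Num.min 2^-1 (Num.min (1 - r / `|x0|) (n / M)).
have t0 : 0 < t.
  rewrite !lt_min invr_gt0 ltr0n divr_gt0//= andbT subr_gt0.
  by rewrite ltr_pdivrMr ?mul1r// (lt_trans r0).
have t1 : t < 1 by rewrite gt_min invf_lt1 ?ltr1n.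
have tr : t <= 1 - r / `|x0| by rewrite !ge_min lexx orbT.
have tM : M * t <= n by rewrite mulrC -ler_pdivlMr// !ge_min lexx !orbT.
exists x, t; split => //; first by rewrite t0.
move=> g gt; have /dual_unit_ballP gle := gt.1.
have fg a : H a -> `|a| <= M -> f a - g a <= 3 * n.
  move=> Ha aM; have [A'a s0 fs] := lift a Ha aM.
  have := slice t g tr gt _ A'a; rewrite dualD dualZ.
  have gu : g u <= 1 := le_trans (le_trans (ler_norm _) (gle u)) u1.
  have := ler_wpM2l s0 gu; lra.
apply/seminorm_ballP => //; exists (3 * n).
  by rewrite mulr_ge0 ?(ltW n0)//= /n; lra.
move=> a Aa; rewrite ler_norml (fg _ (HA _ Aa) (AM _ Aa)) andbT.
(* The hull is symmetric, so the one-sided estimate at [- a] gives the other side. *)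
have HNa : H (- a).
  by rewrite -scaleN1r; apply: closed_abs_convex_hullZ (HA _ Aa); rewrite normrN1.
have := fg _ HNa; rewrite normrN => /(_ (AM _ Aa)).
rewrite -scaleN1r !dualZ; lra.
Qed.

End BallSeparation.

Theorem theorem3p5 (R : realType) (X : completeNormedModType R)
    (C : set (set X)) (hC : compatible_class C) :
  [<->
    (* (a) *) strong_MIP C;
    (* (b) *) forall f : dual X, dual_unit_sphere X f -> strong_semidenting C f;
    (* (c) *) forall (e : R) (A : set X), 0 < e -> C A ->
      tau_dense C (dual_unit_sphere X) (duality_image (M_set e A));
    (* (d) *) norm_tau_quasicontinuous C;
    (* (e) *) forall phi : X -> dual X, support_mapping phi ->
      forall A : set X, dense_in (unit_sphere X) A ->
      tau_dense C (dual_unit_sphere X) (phi @` A)].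
Proof.
have b_app := semidenting_duality_M_approx hC.
have d_app := quasicontinuous_duality_M_approx hC.
have app_b : duality_M_approx C -> sphere_semidenting C.
  by move=> app f f1 A e CA e0; exact: duality_M_approx_slice app _ _ _ f1 CA e0.
tfae.
- exact: strong_MIP_semidenting.
- by move=> /b_app; exact: duality_M_approx_tau_dense.
- move=> /(tau_dense_duality_M_approx hC).
  exact: duality_M_approx_quasicontinuous.
- exact: quasicontinuous_support_mappings.
(* The cycle closes by returning from (e) through (d) and (b) to (a). *)
- move=> /(support_mappings_quasicontinuous hC)/d_app/app_b.
  exact: semidenting_strong_MIP.
Qed.
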